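(* Let $\alpha>0$, $\beta>1$ be real numbers and let $X,Y\sim\mathrm{Unif}\{\alpha,\alpha\beta,\alpha\beta^2\}$. If there exist a real number $m\neq 1$ and four distinct positive integers $j_1,j_2,j_3,j_4$ such that $(j_i,mj_i)\in\mathbb{N}^2$ for $i=1,2,3,4$ and $\{(j_i,mj_i):i=1,2,3,4\}\subseteq\mathcal{U}(X,Y)$, then $X$ and $Y$ are independent.
   Context: $\mathbb{N}=\{1,2,3,\dots\}$. For a random vector $(X,Y)$ whose components have finite moments of all orders, the uncorrelatedness set is $\mathcal{U}(X,Y)=\{(j,k)\in\mathbb{N}^2: \mathbf{E}[X^jY^k]=\mathbf{E}[X^j]\,\mathbf{E}[Y^k]\}$. $X\sim\mathrm{Unif}\{a,b,c\}$ means that $X$ takes each of the three values $a,b,c$ with probability $1/3$; ''$X,Y\sim \mathrm{Unif}\{a,b,c\}$'' means that $(X,Y)$ is a random vector (with an arbitrary joint distribution) both of whose marginals are $\mathrm{Unif}\{a,b,c\}$. *)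

(* Defs.v *)
From HB Require Import structures.
From mathcomp Require Import all_boot all_order all_algebra.
From mathcomp Require Import all_classical all_reals all_analysis.

Set Implicit Arguments.
Unset Strict Implicit.
Unset Printing Implicit Defensive.
Import Order.TTheory GRing.Theory Num.Theory.
Import numFieldNormedType.Exports.

Local Open Scope classical_set_scope.
Local Open Scope ring_scope.

Section uncorrelatedness.
Context d (T : measurableType d) (R : realType) (P : probability T R).

(* Meaningful when [X] and [Y] have finite moments of all orders, in which
   case every expectation below is a finite extended real. *)
Definition uncorrelatedness_set (X Y : {RV P >-> R}) : set (nat * nat) :=
  [set jk | [/\ (0 < jk.1)%N, (0 < jk.2)%N &
    ('E_P[fun w => (X w ^+ jk.1 * Y w ^+ jk.2)%R] =
     'E_P[fun w => (X w ^+ jk.1)%R] * 'E_P[fun w => (Y w ^+ jk.2)%R])%E]].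

(* Intended for pairwise distinct [a], [b], [c]. *)
Definition unif3 (X : {RV P >-> R}) (a b c : R) : Prop :=
  [/\ P (X @^-1` [set a]) = (3^-1)%:E,
      P (X @^-1` [set b]) = (3^-1)%:E &
      P (X @^-1` [set c]) = (3^-1)%:E].

Definition independent_RV (X Y : {RV P >-> R}) : Prop :=
  forall A B : set R, measurable A -> measurable B ->
    P (X @^-1` A `&` Y @^-1` B) = (P (X @^-1` A) * P (Y @^-1` B))%E.

End uncorrelatedness.

(* Main.v *)
Require Import Defs.
From HB Require Import structures.
From mathcomp Require Import all_boot all_order all_algebra.
From mathcomp Require Import all_classical all_reals all_analysis.
From mathcomp Require Import measurable_realfun ring lra.

Set Implicit Arguments.
Unset Strict Implicit.
Unset Printing Implicit Defensive.
Import Order.TTheory GRing.Theory Num.Theory.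
Import numFieldNormedType.Exports.

(** Why the theorem holds.

    Write [x a = alpha * beta ^+ a] for the three values and let
    [q a b = P (X = x a, Y = x b) - 1/9] be the defect of independence.
    The marginals are uniform, so all row sums and column sums of the 3 x 3
    array [q] vanish, and X and Y are independent as soon as [q = 0].

    The joint moment of order (j, k) factors exactly when the bivariate
    polynomial [Q(s, t) = \sum_(a, b) q a b * s ^+ a * t ^+ b] vanishes at
    [s = beta ^+ j], [t = beta ^+ k]; the scale [alpha] cancels.  Since [Q]
    vanishes identically on the lines [s = 1] and [t = 1], it factors as
    [(s - 1) (t - 1) (e00 + e10 s + e01 t + e11 s t)], where the bilinear
    factor has the corner entries of [q], up to sign, as coefficients.  At the
    given points [s] and [t] exceed 1, so the bilinear factor vanishes there.

    On the ray [k = m j] put [s = exp u], [t = exp (m u)] with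
    [u = j ln beta]: the bilinear factor becomes a combination of the four
    exponentials of rates 0, 1, m, 1 + m.  These rates are distinct because
    [m > 0] and [m != 1], and a nontrivial combination of [n] exponentials
    with distinct rates has fewer than [n] real zeros (lemma [exp_sum_eq0], by
    Rolle's theorem).  Four zeros therefore kill all the coefficients, the
    corners of [q] vanish, and the zero row and column sums propagate this to
    all of [q] (lemma [bilinear_exp_eq0]).

    The remaining lemmas reduce expectations and probabilities of random
    variables with finitely many values to finite sums. *)

Local Open Scope classical_set_scope.
Local Open Scope ring_scope.

(** * Zeros of sums of exponentials *)

(** Rolle's theorem between consecutive zeros.  Bounding the new zeros below by
    [x] is what lets the induction concatenate them into a sorted list. *)
Lemma path_zeros_derivative (R : realType) (f f' : R -> R)
    (f_drv : forall x, is_derive x (1 : R) f (f' x)) (x : R) (xs : seq R) :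
    path <%R x xs -> all (fun z => f z == 0) (x :: xs) ->
  exists ys, [/\ size ys = size xs, path <%R x ys &
                 all (fun z => f' z == 0) ys].
Proof.
elim: xs x => [|x2 xs IH] x /=; first by exists [::].
move=> /andP[x_x2 x2_xs] /and3P[/eqP fx0 /eqP fx20 fxs0].
have [|c /[!in_itv]/= /andP[x_c c_x2] c_drv] :=
    @Rolle R f x x2 x_x2 (fun z _ => @ex_derive _ _ _ _ _ _ _ (f_drv z))
      _ (etrans fx0 (esym fx20)).
  by apply: derivable_within_continuous => z _; exact: ex_derive.
have [|ys [ys_size x2_ys ys0]] := IH x2 x2_xs; first by rewrite /= fx20 eqxx.
exists (c :: ys); split => /=; first by rewrite ys_size.
  rewrite x_c /=; case: ys x2_ys {ys_size ys0} => //= y ys /andP[x2_y ->].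
  by rewrite (lt_trans c_x2).
by rewrite ys0 andbT -(@derive_val _ _ _ _ _ _ _ (f_drv c)) derive_val.
Qed.

(** Descartes' bound for exponential sums.  Dividing by the first exponential
    makes that term constant; differentiating then removes it, at the cost of
    one zero, and keeps the remaining rates distinct and the remaining
    coefficients multiplied by nonzero factors. *)
Lemma exp_sum_eq0 (R : realType) (n : nat) (c l : 'I_n -> R) (xs : seq R) :
    injective l -> uniq xs -> size xs = n ->
    (forall x, x \in xs -> \sum_(i < n) c i * expR (l i * x) = 0) ->
  forall i, c i = 0.
Proof.
move=> l_inj xs_uniq xs_size xs0.
have {xs_uniq} : sorted <%R (sort <=%R xs).
  by rewrite lt_sorted_uniq_le sort_uniq xs_uniq sort_le_sorted.
have {xs_size} : size (sort <=%R xs) = n by rewrite size_sort.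
have {xs0} : forall x, x \in sort <=%R xs ->
    \sum_(i < n) c i * expR (l i * x) = 0.
  by move=> x; rewrite mem_sort; exact: xs0.
elim: n c l l_inj {xs}(sort _ xs) => [|n IH] c l l_inj xs xs0 xs_size xs_lt.
  by case.
case: xs xs_size xs0 xs_lt => [//|x xs] [xs_size] xs0 xs_lt.
pose mu i := l (lift ord0 i) - l ord0.
pose f z := c ord0 + \sum_(i < n) c (lift ord0 i) * expR (mu i * z).
have f0 z : z \in x :: xs -> f z = 0.
  move=> /xs0; rewrite big_ord_recl => z0.
  apply: (mulfI (lt0r_neq0 (expR_gt0 (l ord0 * z)))).
  rewrite mulr0 -z0 mulrDr mulrC; congr (_ + _).
  rewrite mulr_sumr; apply: eq_bigr => i _.
  by rewrite mulrCA -expRD -mulrDl /mu addrC subrK.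
pose f' z := \sum_(i < n) (c (lift ord0 i) * mu i) * expR (mu i * z).
have f_drv z : is_derive z (1 : R) f (f' z).
  rewrite /f.
  have -> : (fun z => c ord0 + \sum_(i < n) c (lift ord0 i) * expR (mu i * z)) =
      cst (c ord0) + \sum_(i < n) (fun z => c (lift ord0 i) * expR (mu i * z)).
    by apply/funext => t; rewrite fctE fct_sumE.
  rewrite -[f' z]add0r; apply: is_deriveD; apply: is_derive_sum => i.
  have -> : c (lift ord0 i) * mu i * expR (mu i * z) =
      c (lift ord0 i) *: (expR (mu i * z) * (mu i *: (1 : R))).
    by rewrite /GRing.scale /=; ring.
  exact: is_deriveZ.
have [|ys [ys_size ys_lt ys0]] := path_zeros_derivative f_drv xs_lt.
  by apply/allP => z /f0 ->.
have mu_inj : injective mu.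
  by move=> i j /addIr/l_inj; exact: lift_inj.
have c0 i : c (lift ord0 i) = 0.
  have /(_ i)/eqP : forall i, c (lift ord0 i) * mu i = 0.
    apply: (IH _ mu mu_inj ys) => [z /(allP ys0)/eqP //| |].
      by rewrite ys_size.
    exact: path_sorted ys_lt.
  rewrite mulf_eq0 subr_eq0 (inj_eq l_inj) (eq_sym (lift _ _)).
  rewrite (negPf (neq_lift _ _)) orbF.
  by move/eqP.
move=> i; case: (unliftP ord0 i) => [j ->|->] //.
have := f0 x; rewrite inE eqxx /f => /(_ isT) <-.
by rewrite big1 ?addr0 // => j _; rewrite c0 mul0r.
Qed.

(** * Random variables with finitely many values *)

(** An almost-sure partition is enough because [f] then agrees almost
    everywhere with the simple function [\sum_i c i * \1_(A i)]. *)
Lemma expectation_ae_partition d (T : measurableType d) (R : realType)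
    (P : probability T R) (I : finType) (A : I -> set T) (f : T -> R)
    (c : I -> R) :
    (forall i, measurable (A i)) -> trivIset setT A ->
    (\forall w \ae P, exists i, A i w) ->
    measurable_fun setT f -> (forall i w, A i w -> f w = c i) ->
  ('E_P[f] = (\sum_i c i * fine (P (A i)))%:E)%E.
Proof.
move=> mA tA aeA mf fc; rewrite unlock.
rewrite (@ae_eq_integral _ _ _ _ _
  (fun w => \sum_i (c i)%:E * (\1_(A i) w)%:E)%E) //.
- rewrite integral_sum //; last first.
    by move=> i; apply: integrableZl => //; exact: integrable_indic.
  rewrite -sumEFin; apply: eq_bigr => i _.
  rewrite integralZl ?integral_indic ?setIT //; last exact: integrable_indic.
  by rewrite EFinM fineK // fin_num_measure.
- exact/measurable_EFinP.
- apply: emeasurable_sum => i; apply: measurable_funeM.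
  by apply/measurable_EFinP; exact: measurable_indic.
- apply: filterS aeA => w [i Aiw] _ /=.
  rewrite (bigD1 i) //= big1 ?adde0 => [|k ki].
    by rewrite indicE mem_set // mule1 (fc i).
  rewrite indicE memNset ?mule0 // => Akw.
  by move: ki; rewrite (tA k i) ?eqxx //; exists w.
Qed.

Lemma ae_values d (T : measurableType d) (R : realType)
    (P : probability T R) (I : finType) (X : {RV P >-> R}) (x : I -> R) :
    injective x -> (\sum_i P (X @^-1` [set x i]) = 1)%E ->
  \forall w \ae P, exists i, X w = x i.
Proof.
move=> x_inj x1.
pose D := \bigcup_(i in [set` index_enum I]) (X @^-1` [set x i]).
have mX i : measurable (X @^-1` [set x i]) by exact: measurable_funPTI.
have mD : measurable D by exact: fin_bigcup_measurable.
exists (~` D); split; first exact: measurableC.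
  rewrite [LHS]probability_setC // /D measure_fin_bigcup //.
    by rewrite -fsbig_seq ?index_enum_uniq // x1 subee.
  by move=> i j _ _ [w [/= Xi Xj]]; apply: x_inj; rewrite -Xi.
by apply: subsetC => w [i _ Xi]; exists i; rewrite ?/= ?mem_index_enum.
Qed.

(** Products [g (X w) * h (Y w)] cover both the mixed moments and, with [g] and
    [h] indicators, the probabilities of product events. *)
Lemma expectation_finite_joint d (T : measurableType d) (R : realType)
    (P : probability T R) (I J : finType) (X Y : {RV P >-> R})
    (x : I -> R) (y : J -> R) (g h : R -> R) :
    injective x -> injective y ->
    (\forall w \ae P, exists i, X w = x i) ->
    (\forall w \ae P, exists j, Y w = y j) ->
    measurable_fun setT g -> measurable_fun setT h ->
  ('E_P[fun w => (g (X w) * h (Y w))%R] =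
   (\sum_i \sum_j g (x i) * h (y j) *
      fine (P (X @^-1` [set x i] `&` Y @^-1` [set y j])))%R%:E)%E.
Proof.
move=> x_inj y_inj Xx Yy mg mh.
rewrite (@expectation_ae_partition _ _ _ _ (I * J)%type
    (fun ij => X @^-1` [set x ij.1] `&` Y @^-1` [set y ij.2]) _
    (fun ij => g (x ij.1) * h (y ij.2))); first by rewrite pair_bigA.
- by move=> ij; apply: measurableI; exact: measurable_funPTI.
- move=> [i j] [i' j'] _ _ [w [[/= Xi Yj] [Xi' Yj']]].
  by congr pair; [apply: x_inj; rewrite -Xi|apply: y_inj; rewrite -Yj].
- apply: filterS2 Xx Yy => w [i Xi] [j Yj]; by exists (i, j).
- apply: measurable_funM; exact: measurableT_comp.
- by move=> ij w [/= -> ->].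
Qed.

(** A joint law of product form determines [p] and [q] only up to inverse
    scalings, which cancel: with [a A] and [b B] the sums of [p] and [q] over [A] and [B], product
    events have probability [a A * b B], so that [a setT * b setT = 1] and the
    marginals are [a A * b setT] and [a setT * b B]. *)
Lemma independent_finite d (T : measurableType d) (R : realType)
    (P : probability T R) (I J : finType) (X Y : {RV P >-> R})
    (x : I -> R) (y : J -> R) (p : I -> R) (q : J -> R) :
    injective x -> injective y ->
    (\forall w \ae P, exists i, X w = x i) ->
    (\forall w \ae P, exists j, Y w = y j) ->
    (forall i j, fine (P (X @^-1` [set x i] `&` Y @^-1` [set y j])) =
      p i * q j) ->
  independent_RV X Y.
Proof.
move=> x_inj y_inj Xx Yy pq.
pose a (A : set R) : R := \sum_i \1_A (x i) * p i.
pose b (B : set R) : R := \sum_j \1_B (y j) * q j.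
have Pab A B : measurable A -> measurable B ->
    P (X @^-1` A `&` Y @^-1` B) = (a A * b B)%:E.
  move=> mA mB.
  have mXY : measurable (X @^-1` A `&` Y @^-1` B).
    by apply: measurableI; exact: measurable_funPTI.
  rewrite -(expectation_indic P mXY).
  have -> : \1_(X @^-1` A `&` Y @^-1` B) =
      (fun w => \1_A (X w) * \1_B (Y w)) :> (T -> R).
    by rewrite indicI.
  rewrite (@expectation_finite_joint _ _ _ _ _ _ X Y x y \1_A \1_B) //.
  congr EFin; rewrite /a /b mulr_suml; apply: eq_bigr => i _.
  by rewrite mulr_sumr; apply: eq_bigr => j _; rewrite pq mulrACA.
have ab1 : a setT * b setT = 1.
  apply: EFin_inj; rewrite -Pab // !preimage_setT setIT.
  exact: probability_setT.
move=> A B mA mB; rewrite Pab //.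
have -> : P (X @^-1` A) = (a A * b setT)%:E.
  by rewrite -Pab // preimage_setT setIT.
have -> : P (Y @^-1` B) = (a setT * b B)%:E.
  by rewrite -Pab // preimage_setT setTI.
rewrite -EFinM; congr EFin.
by rewrite mulrACA [b _ * b _]mulrC mulrACA ab1 mulr1.
Qed.

Lemma marginal_finite_joint d (T : measurableType d) (R : realType)
    (P : probability T R) (I J : finType) (X Y : {RV P >-> R})
    (x : I -> R) (y : J -> R) (i : I) :
    injective x -> injective y ->
    (\forall w \ae P, exists i, X w = x i) ->
    (\forall w \ae P, exists j, Y w = y j) ->
  P (X @^-1` [set x i]) =
    (\sum_j fine (P (X @^-1` [set x i] `&` Y @^-1` [set y j])))%:E.
Proof.
move=> x_inj y_inj Xx Yy.
have mX : measurable (X @^-1` [set x i]) by exact: measurable_funPTI.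
rewrite -(expectation_indic P mX).
have -> : \1_(X @^-1` [set x i]) =
    (fun w => \1_[set x i] (X w) * cst 1 (Y w)) :> (T -> R).
  by apply/funext => w; rewrite mulr1.
rewrite (@expectation_finite_joint _ _ _ _ _ _ X Y x y \1_[set x i] (cst 1)) //.
congr EFin; rewrite (bigD1 i) //= [X in _ + X]big1 ?addr0 => [|k ki].
  by apply: eq_bigr => j _; rewrite indicE mem_set // !mul1r.
apply: big1 => j _; rewrite indicE memNset ?mul0r //= => /x_inj ik.
by rewrite ik eqxx in ki.
Qed.

(** * The defect of independence *)

(** The polynomial [\sum_(a, b) d a b * s ^+ a * t ^+ b] vanishes on [s = 1]
    and on [t = 1] by the conditions on column and row sums.  Dividing by
    [(s - 1) (t - 1)] leaves four terms, which become exponentials of rates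
    0, 1, m, 1 + m along [s = exp x], [t = exp (m x)]. *)
Lemma bilinear_exp_eq0 (R : realType) (m : R) (d : nat -> nat -> R)
    (xs : seq R) :
    0 < m -> m != 1 -> uniq xs -> size xs = 4%N -> 0 \notin xs ->
    (forall a, (a < 3)%N -> \sum_(b < 3) d a b = 0) ->
    (forall b, (b < 3)%N -> \sum_(a < 3) d a b = 0) ->
    (forall x, x \in xs ->
       \sum_(a < 3) \sum_(b < 3) d a b * (expR x ^+ a * expR (m * x) ^+ b) = 0) ->
  forall a b, (a < 3)%N -> (b < 3)%N -> d a b = 0.
Proof.
move=> m0 m1 xs_uniq xs_size xs0 row col dxs.
(* Coefficients of 1, s, t and s t after division by (s - 1) (t - 1). *)
pose c (i : 'I_4) := [:: d 0 0; - d 2 0; - d 0 2; d 2 2]`_i : R.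
pose l (i : 'I_4) := [:: 0; 1; m; 1 + m]`_i : R.
have sum3 (F : nat -> R) : \sum_(i < 3) F i = F 0%N + F 1%N + F 2%N.
  by rewrite !big_ord_recr big_ord0 /= add0r.
have [r0 r1 r2] := And3 (row 0%N isT) (row 1%N isT) (row 2%N isT).
have [c0 c1 c2] := And3 (col 0%N isT) (col 1%N isT) (col 2%N isT).
rewrite !sum3 in r0 r1 r2.
rewrite (sum3 (d ^~ 0%N)) in c0; rewrite (sum3 (d ^~ 1%N)) in c1.
rewrite (sum3 (d ^~ 2%N)) in c2.
have l_inj : injective l.
  move=> [i i4] [j j4]; rewrite /l /= => lij; apply: val_inj => /=; move: lij.
  case: i i4 => [|[|[|[|]]]] //; case: j j4 => [|[|[|[|]]]] //= _ _ lij //;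
    suff: false by []; lra.
have {}dxs (x : R) : x \in xs -> \sum_(i < 4) c i * expR (l i * x) = 0.
  move=> xxs; have := dxs x xxs.
  have x0 : x != 0 by apply: contraNneq xs0 => <-.
  rewrite (sum3 (fun a => \sum_(b < 3) d a b *
                            (expR x ^+ a * expR (m * x) ^+ b))).
  rewrite !(sum3 (fun b => d _ b * (expR x ^+ _ * expR (m * x) ^+ b))).
  rewrite !big_ord_recl big_ord0 /c /l /=.
  rewrite mul0r expR0 mul1r [(1 + m) * x]mulrDl mul1r expRD.
  have : expR x - 1 != 0 by rewrite subr_eq0 -expR0 (inj_eq (@expR_inj R)).
  have : expR (m * x) - 1 != 0.
    by rewrite subr_eq0 -expR0 (inj_eq (@expR_inj R)) mulf_neq0 // gt_eqF.
  move: (expR x) (expR (m * x)) => s t t1 s1 st0.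
  apply: (mulfI s1); apply: (mulfI t1); rewrite !mulr0 -[RHS]st0.
  (* The corners parametrize the arrays with zero row and column sums; in
     terms of them the factorization is a polynomial identity. *)
  have -> : d 0%N 1%N = - d 0%N 0%N - d 0%N 2%N by lra.
  have -> : d 1%N 0%N = - d 0%N 0%N - d 2%N 0%N by lra.
  have -> : d 1%N 2%N = - d 0%N 2%N - d 2%N 2%N by lra.
  have -> : d 2%N 1%N = - d 2%N 0%N - d 2%N 2%N by lra.
  have -> : d 1%N 1%N = d 0%N 0%N + d 0%N 2%N + d 2%N 0%N + d 2%N 2%N by lra.
  ring.
have c_eq0 := exp_sum_eq0 l_inj xs_uniq xs_size dxs.
have [/= d00 d20 d02 d22] := And4 (c_eq0 (@Ordinal 4 0 isT))
  (c_eq0 (@Ordinal 4 1 isT)) (c_eq0 (@Ordinal 4 2 isT))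
  (c_eq0 (@Ordinal 4 3 isT)).
rewrite /c /= in d00 d20 d02 d22.
by move=> [|[|[|a]]] [|[|[|b]]] //= _ _; lra.
Qed.

Theorem theorem3p5 (d : measure_display) (T : measurableType d) (R : realType)
    (P : probability T R) (X Y : {RV P >-> R}) (alpha beta : R)
    (halpha : 0 < alpha) (hbeta : 1 < beta)
    (hX : unif3 X alpha (alpha * beta) (alpha * beta ^+ 2))
    (hY : unif3 Y alpha (alpha * beta) (alpha * beta ^+ 2))
    (hU : exists (m : R) (j k : 'I_4 -> nat),
      [/\ m != 1, injective j,
          (forall i, (0 < j i)%N /\ (0 < k i)%N),
          (forall i, (k i)%:R = m * (j i)%:R) &
          (forall i, uncorrelatedness_set X Y (j i, k i))]) :
  independent_RV X Y.
Proof.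
pose x (a : 'I_3) : R := alpha * beta ^+ a.
have x_inj : injective x.
  move=> a b /(mulfI (lt0r_neq0 halpha)) /ieexprIn-/(_ _ _)/val_inj; apply.
    by rewrite (lt_trans ltr01).
  by rewrite gt_eqF.
have unif_x (Z : {RV P >-> R}) : unif3 Z alpha (alpha * beta) (alpha * beta ^+ 2) ->
    forall a, P (Z @^-1` [set x a]) = (3^-1)%:E.
  rewrite /x => -[Z0 Z1 Z2] [[|[|[|]]] // ?] /=.
  by rewrite expr0 mulr1.
have ae_x (Z : {RV P >-> R}) : unif3 Z alpha (alpha * beta) (alpha * beta ^+ 2) ->
    \forall w \ae P, exists a, Z w = x a.
  move=> /unif_x Zx; apply: ae_values => //.
  under eq_bigr do rewrite Zx.
  rewrite sumEFin sumr_const card_ord; congr EFin; lra.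
have moment (Z : {RV P >-> R}) n :
    unif3 Z alpha (alpha * beta) (alpha * beta ^+ 2) ->
    ('E_P[fun w => (Z w ^+ n)%R] = (\sum_a x a ^+ n / 3)%R%:E)%E.
  move=> Zu; rewrite (@expectation_ae_partition _ _ _ _ _
    (fun a => Z @^-1` [set x a]) _ (fun a => x a ^+ n)).
  - by congr EFin; apply: eq_bigr => a _; rewrite unif_x.
  - by move=> a; exact: measurable_funPTI.
  - by move=> a b _ _ [w [/= Za Zb]]; apply: x_inj; rewrite -Za.
  - exact: ae_x.
  - exact: measurable_funX.
  - by move=> a w /= ->.
pose p (a b : nat) : R :=
  fine (P (X @^-1` [set alpha * beta ^+ a] `&` Y @^-1` [set alpha * beta ^+ b])).
have p_row (a : 'I_3) : \sum_(b < 3) p a b = 3^-1.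
  apply: EFin_inj; rewrite -(unif_x X hX a).
  by rewrite (@marginal_finite_joint _ _ _ _ _ _ X Y x x) //; exact: ae_x.
have p_col (b : 'I_3) : \sum_(a < 3) p a b = 3^-1.
  apply: EFin_inj; rewrite -(unif_x Y hY b).
  rewrite (@marginal_finite_joint _ _ _ _ _ _ Y X x x) //; try exact: ae_x.
  by congr EFin; apply: eq_bigr => a _; rewrite setIC.
have [m [j [k [m1 j_inj jk0 kE jkU]]]] := hU.
have m0 : 0 < m.
  have [j0 k0] := jk0 ord0.
  by rewrite -(@pmulr_lgt0 _ (j ord0)%:R) ?ltr0n // -kE ltr0n.
have lnb0 : 0 < ln beta by rewrite ln_gt0.
have expR_jln n : expR (n%:R * ln beta) = beta ^+ n.
  by rewrite expRM_natl lnK // posrE (lt_trans ltr01).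
(* The marginals are uniform, so independence means p a b = 1/9. *)
pose q a b := p a b - 9^-1.
(* These are the four points u = j ln beta. *)
pose xs := [seq (j i)%:R * ln beta | i <- enum 'I_4].
have q0 : forall a b, (a < 3)%N -> (b < 3)%N -> q a b = 0.
  apply: (@bilinear_exp_eq0 _ m _ xs) => //.
  - rewrite map_inj_uniq ?enum_uniq // => i i' /(mulIf (lt0r_neq0 lnb0)) /eqP.
    by rewrite eqr_nat => /eqP/j_inj.
  - by rewrite size_map size_enum_ord.
  - apply/mapP => -[i _ /esym/eqP]; apply/negP.
    by rewrite gt_eqF // mulr_gt0 // ltr0n; case: (jk0 i).
  - move=> a a3; rewrite sumrB (p_row (Ordinal a3)) sumr_const card_ord; lra.
  - move=> b b3; rewrite sumrB (p_col (Ordinal b3)) sumr_const card_ord; lra.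
  move=> _ /mapP[i _ ->].
  have -> : m * ((j i)%:R * ln beta) = (k i)%:R * ln beta by rewrite mulrA kE.
  rewrite !expR_jln.
  have [_ _ /=] := jkU i; rewrite (moment X) // (moment Y) //.
  rewrite (@expectation_finite_joint _ _ _ _ _ _ X Y x x
     (fun z => z ^+ j i) (fun z => z ^+ k i)) //; try exact: ae_x;
    try exact: exprn_measurable.
  rewrite -EFinM => -[/eqP]; rewrite -subr_eq0 mulr_suml -sumrB => /eqP sum0.
  (* Both mixed moments carry the same power of alpha, which cancels. *)
  apply: (@mulfI _ (alpha ^+ j i * alpha ^+ k i)).
    by rewrite mulf_neq0 // expf_neq0 // gt_eqF.
  rewrite mulr0 -[RHS]sum0 mulr_sumr; apply: eq_bigr => a _.
  rewrite !mulr_sumr -sumrB; apply: eq_bigr => b _.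
  rewrite /x /q -/(p a b) !exprMn -!exprM.
  by rewrite [(a * j i)%N]mulnC [(b * k i)%N]mulnC; field.
apply: (@independent_finite _ _ _ _ _ _ X Y x x (fun=> 3^-1) (fun=> 3^-1)) => //;
  try exact: ae_x.
move=> a b; have /eqP := q0 a b (ltn_ord a) (ltn_ord b).
by rewrite subr_eq0 => /eqP; rewrite /p => ->; lra.
Qed.
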